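(* Let $G=(V,E)$ be any simple, connected graph (with $|E|\ge2$). If $p=p(n)\in(0,1)$ satisfies $p\le1-\varepsilon$ for some $\varepsilon>0$ (independent of $n$) and $n\,p^{d'(G)}\,(\log(1/p))^{-|E|}\to\infty$ as $n\to\infty$, then under the Erdős–Rényi measure $\mu_{n,p}$ $$\frac{T_G-\mathbb E_{\mu_{n,p}}T_G}{2\,|\mathrm{Aut}(G)|^{-1}\,|E|\,(n-2)_{|V|-2}\;p^{|E|-1}\sqrt{\binom n2p(1-p)}}\Rightarrow\mathcal N(0,1),$$ where $\Rightarrow$ denotes convergence in distribution as $n\to\infty$.
   Context: $\mathcal I_n$ is the set of edges (unordered pairs) of the complete graph on $[n]=\{1,\dots,n\}$, and $\mu_{n,p}$ is the product measure on $\{0,1\}^{\mathcal I_n}$ with $\mu_{n,p}(x_e=1)=p$ (Erdős–Rényi model). $T_G$ is the number of copies of $G$ in the random graph: $$T_G(X)=\frac1{|\mathrm{Aut}(G)|}\sum_{f:V\to[n]\text{ injective}}\ \prod_{e\in E}X_{f(e)},\qquad f(e)=\{f(v_1),f(v_2)\}\text{ for }e=\{v_1,v_2\}.$$ $d'(G)=\max_{H\subset G,\ |E(H)|\ge2}\frac{2|E(H)|-1}{|V(H)|-2}$, the maximum over subgraphs $H$ of $G$ with at least two edges. $(n)_k=n(n-1)\cdots(n-k+1)$. *)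

(* Defs.v *)
From HB Require Import structures.
From mathcomp Require Import all_boot all_order all_algebra all_fingroup.
From mathcomp Require Import all_classical all_reals all_analysis.

Set Implicit Arguments.
Unset Strict Implicit.
Unset Printing Implicit Defensive.

Import Order.TTheory GRing.Theory Num.Theory.
Import numFieldNormedType.Exports.

Local Open Scope classical_set_scope.
Local Open Scope ring_scope.

(* Unordered pairs of distinct elements of V, i.e. the edges of the complete
   graph on V.  A simple graph with vertex set V is given by its edge set
   E : {set edge V}. *)
Definition edge (V : finType) := {e : {set V} | #|e| == 2}.

Definition injection (V W : finType) := {f : {ffun V -> W} | injectiveb f}.

Lemma edge_imset_subproof (V W : finType) (f : injection V W) (e : edge V) :
  #|[set val f v | v in val e]%SET| == 2.
Proof. by rewrite card_imset ?(eqP (valP e))//; exact/injectiveP/(valP f). Qed.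

Definition edge_imset (V W : finType) (f : injection V W) (e : edge V) :
  edge W := Sub [set val f v | v in val e]%SET (edge_imset_subproof f e).

Section simple_graphs.
Context (V : finType).
Implicit Type E : {set edge V}.

Definition adjacent E : rel V :=
  [rel x y | [exists e in E, val e == [set x; y]%SET]].

Definition connected_graph E : Prop :=
  (0 < #|V|)%N /\ forall x y : V, connect (adjacent E) x y.

Definition graph_aut E : {set {perm V}} :=
  [set s : {perm V} |
    [forall x, forall y, adjacent E (s x) (s y) == adjacent E x y]]%SET.

Definition is_subgraph E (H : {set V} * {set edge V}) : bool :=
  (H.2 \subset E) && [forall e in H.2, val e \subset H.1].

(* If H has at least two edges then |V(H)| >= 3, so every term of the maximum is
   positive and the default value 0 plays no role as soon as |E| >= 2. *)
Definition dprime (R : realType) E : R :=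
  \big[Num.max/0]_(H : {set V} * {set edge V}
      | is_subgraph E H && (2 <= #|H.2|)%N)
    ((2 * #|H.2|%:R - 1) / (#|H.1|%:R - 2)).

End simple_graphs.

(* {0,1}^{I_n}, with the discrete sigma-algebra *)
Definition config (n : nat) : Type := {ffun edge 'I_n -> bool}.

HB.instance Definition _ n := Finite.on (config n).

Section config_measurable.
Context (n : nat).
HB.instance Definition _ := isPointed.Build (config n) [ffun=> false].
HB.instance Definition _ := @isMeasurable.Build default_measure_display
  (config n) discrete_measurable discrete_measurable0
  discrete_measurableC discrete_measurableU.
End config_measurable.

Definition erdos_renyi (R : realType) (n : nat) (p : R) :
    set (config n) -> \bar R :=
  fun A => (\sum_(x \in A)
    (\prod_(e : edge 'I_n) fine (bernoulli_prob p [set x e]))%:E)%E.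

Arguments erdos_renyi {R} n p.

Section erdos_renyi_probability.
Context (R : realType) (n : nat) (p : R).

Let w (x : config n) : R :=
  \prod_(e : edge 'I_n) fine (bernoulli_prob p [set x e]).

Let w_ge0 x : 0 <= w x.
Proof. by apply: prodr_ge0 => e _; exact: fine_ge0. Qed.

Local Notation er := (@erdos_renyi R n p).

Let erdos_renyi0 : er set0 = 0%E.
Proof. by rewrite /erdos_renyi fsbig_set0. Qed.

Let erdos_renyi_ge0 A : (0 <= er A)%E.
Proof.
rewrite /erdos_renyi fsbig_finite//= sumEFin lee_fin.
by apply: sumr_ge0 => x _; exact: w_ge0.
Qed.

Let erdos_renyi_sigma_additive : semi_sigma_additive er.
Proof.
move=> F mF tF mUF.
have esumE A : (\esum_(x in A) (w x)%:E = er A)%E.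
  by apply: esum_fset => [|x _]; [exact: finite_finset|rewrite lee_fin].
apply: cvg_toP.
  apply: ereal_nondecreasing_is_cvgn => a b ab.
  by apply: lee_sum_nneg_natr => // k _ _; exact: erdos_renyi_ge0.
rewrite -esumE nneseries_sum_bigcup//; exact: eq_eseriesr.
Qed.

HB.instance Definition _ := isMeasure.Build _ _ _ er
  erdos_renyi0 erdos_renyi_ge0 erdos_renyi_sigma_additive.

Let bernoulli_sum :
  \sum_(b : bool) fine (bernoulli_prob p [set b]) = 1 :> R.
Proof.
have /(congr1 fine) := probability_setT (bernoulli_prob p).
rewrite setT_bool measureU//; last by rewrite -subset0 => -[] [].
by rewrite fineD ?fin_num_measure// big_bool.
Qed.

Let erdos_renyi_setT : er [set: _] = 1%E.
Proof.
have -> : [set: config n] = [set` enum {: config n}].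
  by apply/seteqP; split=> // x _ /=; rewrite mem_enum.
rewrite /erdos_renyi -fsbig_seq ?enum_uniq// sumEFin big_enum/=.
rewrite -(bigA_distr_bigA (fun _ b => fine (bernoulli_prob p [set b]))).
by rewrite big1// => e _; exact: bernoulli_sum.
Qed.

HB.instance Definition _ :=
  @Measure_isProbability.Build _ _ R er erdos_renyi_setT.

Lemma erdos_renyi_set1 (x : config n) : 0 <= p <= 1 ->
  er [set x] = (\prod_(e : edge 'I_n) (if x e then p else 1 - p))%:E.
Proof.
move=> p01; rewrite /erdos_renyi fsbig_set1; congr EFin.
apply: eq_bigr => e _; rewrite /bernoulli_prob p01 fsbig_set1 /=.
by case: (x e).
Qed.

End erdos_renyi_probability.

Definition config_fun (R : realType) n (f : config n -> R) : config n -> R := f.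

Section config_fun_measurable.
Context (R : realType) (n : nat) (f : config n -> R).
Let measurable_config_fun : measurable_fun setT (config_fun f).
Proof. by []. Qed.
HB.instance Definition _ :=
  isMeasurableFun.Build _ _ _ _ (config_fun f) measurable_config_fun.
End config_fun_measurable.

Definition config_RV (R : realType) n (P : probability (config n) R)
  (f : config n -> R) : {RV P >-> R} := config_fun f.

Definition subgraph_count (R : realType) (V : finType) (E : {set edge V}) n
    (X : config n) : R :=
  #|graph_aut E|%:R^-1 *
  \sum_(f : injection V 'I_n) \prod_(e in E) (X (edge_imset f e))%:R.

Arguments subgraph_count R {V} E {n} X.

(* Convergence in distribution: convergence of the distribution functions at
   every continuity point of the limit distribution function; the X_ n may live
   on different probability spaces. *)
Definition cvg_in_distribution (R : realType) (d : nat -> measure_display)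
    (T : forall n, measurableType (d n)) (P : forall n, probability (T n) R)
    (X : forall n, {RV (P n) >-> R}) (nu : probability (measurableTypeR R) R) : Prop :=
  forall t : R, {for t, continuous (fun s : R => nu `]-oo, s]%classic)} ->
    cdf (X n) t @[n --> \oo] --> nu `]-oo, t]%classic.

(* Main.v *)
(* Centre every edge variable, Y_e = X_e - p, and expand the product over the
   edges of a copy: T_G - E T_G is a sum over the nonempty A \subset E of
   p^(|E|-|A|) Z_A, where Z_A sums \prod_(e in A) Y_(f e) over the embeddings f.
   By symmetry the |A| = 1 part is a multiple of \sum_e Y_e, and the denominator
   of the theorem is exactly that multiple times the standard deviation of
   \sum_e Y_e.  The products of the Y_e over distinct edge sets are orthogonal,
   so E Z_A^2 counts pairs of embeddings with f(A) = g(A); after normalisation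
   the part with |A| >= 2 has second moment O(1 / (n^(v-2) p^(|A|-1))), v being
   the number of vertices covered by A, and this is O(1 / (n p^d'(G))).  For the
   linear part, Stein's method yields a normal approximation with error
   O(1 / s), s^2 = C(n,2) p (1-p), against Lipschitz test functions; ramps
   approximating the indicator of ]-oo, t] turn this into convergence of the
   distribution functions. *)
Require Import Defs.
From HB Require Import structures.
From mathcomp Require Import all_boot all_order all_algebra all_fingroup.
From mathcomp Require Import all_classical all_reals all_analysis.
From mathcomp Require Import measurable_realfun ring lra zify.
Import Order.TTheory GRing.Theory Num.Theory.
Import numFieldNormedType.Exports.
Local Open Scope classical_set_scope.
Local Open Scope ring_scope.

Set Implicit Arguments.
Unset Strict Implicit.
Unset Printing Implicit Defensive.

(** * Stein's equation for the standard normal law *)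

Section stein_equation.
Context {R : realType}.
Implicit Types (f h : R -> R) (x y : R).
Local Notation mu := (@lebesgue_measure R).
Local Notation phi := (normal_pdf (0 : R) 1).

Lemma phiE x : phi x = normal_peak 1 * expR (- x ^+ 2 / 2).
Proof.
by rewrite normal_pdfE ?oner_neq0// /normal_fun subr0 expr1n.
Qed.

Lemma phi_gt0 x : 0 < phi x.
Proof. by rewrite phiE mulr_gt0 ?expR_gt0// normal_peak_gt0 ?oner_neq0. Qed.

Lemma phiN x : phi (- x) = phi x.
Proof. by rewrite !phiE sqrrN. Qed.

Lemma continuous_phi : continuous phi.
Proof. by apply: continuous_normal_pdf; rewrite oner_neq0. Qed.

Lemma is_derive_phi x : is_derive x 1 phi (- x * phi x).
Proof.
rewrite (_ : phi = (fun y : R => normal_peak 1 * expR (- y ^+ 2 / 2))); last first.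
  by apply/funext => y; exact: phiE.
apply: is_derive_eq; rewrite /GRing.scale/=. by field.
Qed.

Lemma integrable_phi (A : set R) : measurable A ->
  mu.-integrable A (EFin \o phi).
Proof.
move=> mA; apply: (integrableS measurableT) => //.
exact: integrable_normal_pdf.
Qed.

(* [2 phi x / (1 + x)] dominates the Gaussian tail on the positive half-line:
   minus its derivative is [phi x] times a factor that is at least 1. *)
Lemma is_derive_tail x : 0 <= x ->
  is_derive x 1 (fun y => - (2 * phi y / (1 + y)))
    (2 * phi x * (x / (1 + x) + (1 + x) ^- 2)).
Proof.
move=> x0.
have x1 : 1 + x != 0 by lra.
have dphi := is_derive_phi x.
have dinv : is_derive x 1 (fun y => (1 + y)^-1) (- (1 + x) ^- 2 *: (0 + 1)).
  by apply: is_deriveV.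
apply: is_derive_eq; rewrite /GRing.scale/=. by field.
Qed.

Lemma cvg_tail0 : - (2 * phi x / (1 + x)) @[x --> +oo] --> (0 : R).
Proof.
apply/cvgr0Pnorm_le => e e0; near=> x.
have x0 : 0 < x by near: x; apply: nbhs_pinfty_gt; exact: num_real.
(* The density is at most [normal_peak 1], so past this threshold the fraction is below [e]. *)
have xe : 2 * normal_peak 1 / e <= x by near: x; apply: nbhs_pinfty_ge; exact: num_real.
rewrite normrN ger0_norm; last by rewrite divr_ge0 ?mulr_ge0 ?normal_pdf_ge0//; lra.
rewrite ler_pdivrMr; last by lra.
have := @normal_pdf_ub R 0 1 x (oner_neq0 _).
move: xe; rewrite ler_pdivrMr// => xe ub.
by nra.
Unshelve. all: by end_near. Qed.

Lemma continuous_tail_pdf x : 0 <= x ->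
  {for x, continuous (fun y => 2 * phi y * (y / (1 + y) + (1 + y) ^- 2))}.
Proof.
move=> x0; have x1 : 1 + x != 0 by lra.
have c1 : (fun y => 1 + y) y @[y --> x] --> 1 + x.
  by apply: cvgD; [exact: cvg_cst|exact: cvg_id].
apply: cvgM; first by apply: cvgM; [exact: cvg_cst|exact: continuous_phi].
apply: cvgD; first by apply: cvgM; [exact: cvg_id|exact: cvgV].
by apply: cvgV; [rewrite expf_neq0|exact: cvgM].
Qed.

(** Unlike [phi x / x], this bound stays finite at 0, so a single estimate later controls both [f]
    and [x * f x]. *)
Lemma phi_tail x : 0 <= x ->
  \int[mu]_(y in `]x, +oo[) phi y <= 2 * phi x / (1 + x).
Proof.
move=> x0.
rewrite Rintegral_itv_obnd_cbnd; last exact: integrable_phi.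
have ctail : {within `[x, +oo[, continuous
    (fun y => 2 * phi y * (y / (1 + y) + (1 + y) ^- 2))}.
  apply: continuous_in_subspaceT => y; rewrite inE/= in_itv/= andbT => xy.
  by apply: continuous_tail_pdf; exact: le_trans xy.
have Fx : - (2 * phi y / (1 + y)) @[y --> x^'+] --> - (2 * phi x / (1 + x)).
  apply: cvg_at_right_filter.
  have := is_derive_tail x0 => /@ex_derive/derivable1_diffP/differentiable_continuous.
  exact.
have pdf_ge0 y : x <= y -> 0 <= 2 * phi y * (y / (1 + y) + (1 + y) ^- 2).
  move=> xy; have y0 : 0 <= y by exact: le_trans xy.
  by rewrite mulr_ge0 ?mulr_ge0 ?normal_pdf_ge0 ?addr_ge0 ?divr_ge0 ?invr_ge0 ?exprn_ge0//; lra.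
have := @ge0_continuous_FTC2y R
  (fun y => 2 * phi y * (y / (1 + y) + (1 + y) ^- 2))
  (fun y => - (2 * phi y / (1 + y))) x 0 pdf_ge0 ctail cvg_tail0 _ Fx.
rewrite -EFinB sub0r opprK => FTC.
rewrite -lee_fin /Rintegral fineK; last first.
  by apply: integrable_fin_num => //; exact: integrable_phi.
rewrite -FTC; last 2 first.
- move=> y xy; have y0 : 0 <= y by exact/ltW/(le_lt_trans x0).
  exact: (@ex_derive _ _ _ _ _ _ _ (is_derive_tail y0)).
- move=> y; rewrite in_itv/= andbT => xy.
  have y0 : 0 <= y by exact/ltW/(le_lt_trans x0).
  by rewrite derive1E (@derive_val _ _ _ _ _ _ _ (is_derive_tail y0)).
apply: ge0_le_integral => //=.
- by move=> y _; rewrite lee_fin normal_pdf_ge0.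
- by apply/measurable_EFinP/measurable_funTS; exact: measurable_normal_pdf.
- apply/measurable_EFinP; apply: subspace_continuous_measurable_fun => //.
- move=> y; rewrite in_itv/= andbT => xy; rewrite lee_fin.
  have y0 : 0 <= y by exact: le_trans xy.
  rewrite -mulrA mulrCA ler_peMr ?normal_pdf_ge0//.
  (* The derivative exceeds [phi y] by this nonnegative multiple of [phi y]. *)
  rewrite -subr_ge0 (_ : _ - _ = (y ^+ 2 + 1) / (1 + y) ^+ 2).
    by rewrite divr_ge0 ?sqr_ge0// addr_ge0 ?sqr_ge0.
  by field; lra.
Qed.


Lemma phi_tailN x : x <= 0 ->
  \int[mu]_(y in `]-oo, x]) phi y <= 2 * phi x / (1 - x).
Proof.
move=> x0; have := @phi_tail (- x).
rewrite phiN oppr_ge0 => /(_ x0); congr (_ <= _).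
rewrite Rintegral_itv_obnd_cbnd; last exact: integrable_phi.
have := @ge0_integration_by_substitutionNy R phi (- x).
rewrite opprK /Rintegral => ->.
- by congr fine; apply: eq_integral => y _ /=; rewrite phiN.
- by apply: continuous_subspaceT; exact: continuous_phi.
- by move=> y _; exact: normal_pdf_ge0.
Qed.

(** * The bounded solution of Stein's equation *)

Section solution.
Variable h : R -> R.
Hypothesis ch : continuous h.
Hypothesis h01 : forall x, 0 <= h x <= 1.

Definition gauss_mean : R := \int[mu]_y (h y * phi y).

Let measurable_h : measurable_fun setT h.
Proof. exact: continuous_measurable_fun. Qed.

Let integrable_hphi (A : set R) : measurable A ->
  mu.-integrable A (EFin \o (fun y => h y * phi y)).
Proof.
move=> mA; apply: (@le_integrable _ _ _ mu A mA _ _ _ _ (integrable_phi mA)).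
  apply/measurable_EFinP/measurable_funTS/measurable_funM => //.
  exact: measurable_normal_pdf.
move=> y _ /=; have /andP[h0 h1] := h01 y.
by rewrite lee_fin normrM ler_piMl// ger0_norm.
Qed.

Let integral_phi : \int[mu]_y phi y = 1.
Proof. by rewrite /Rintegral integral_normal_pdf. Qed.

Lemma gauss_mean01 : 0 <= gauss_mean <= 1.
Proof.
apply/andP; split.
  apply: Rintegral_ge0 => y _.
  by have /andP[h0 h1] := h01 y; rewrite mulr_ge0 ?normal_pdf_ge0.
rewrite -integral_phi; apply: le_Rintegral => //.
- exact: integrable_hphi.
- exact: integrable_phi.
- by move=> y _; have /andP[h0 h1] := h01 y; rewrite ler_piMl ?normal_pdf_ge0.
Qed.

Let g y := (h y - gauss_mean) * phi y.

Let integrable_g (A : set R) : measurable A -> mu.-integrable A (EFin \o g).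
Proof.
move=> mA.
rewrite (_ : EFin \o g = (fun y => (h y * phi y)%:E - (gauss_mean * phi y)%:E)%E).
  apply: integrableB => //; first exact: integrable_hphi.
  exact: (@integrableZl _ _ _ mu A mA gauss_mean _ (integrable_phi mA)).
by apply/funext => y /=; rewrite /g mulrBl.
Qed.

Let integral_g : \int[mu]_y g y = 0.
Proof.
rewrite /g; under eq_Rintegral do rewrite mulrBl.
rewrite RintegralB//=; first last.
- exact: (@integrableZl _ _ _ mu _ _ gauss_mean _ (integrable_phi _)).
- exact: integrable_hphi.
by rewrite RintegralZl//; [rewrite integral_phi mulr1 subrr|exact: integrable_phi].
Qed.

Let g_le_phi y : `|g y| <= phi y.
Proof.
rewrite /g normrM [`|phi y|]ger0_norm ?normal_pdf_ge0// ler_piMl ?normal_pdf_ge0//.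
by have := h01 y; have := gauss_mean01; rewrite ler_norml; lra.
Qed.

Let G x := \int[mu]_(y in `]-oo, x]) g y.

Let is_derive_G x : is_derive x 1 G (g x).
Proof.
(* [x + 1] is an arbitrary point to the right of [x], so that [x] is interior to the interval of
   integration. *)
have xx1 : x < x + 1 by lra.
have cg : {for x, continuous g}.
  by apply: cvgM; [apply: cvgB; [exact: ch|exact: cvg_cst]|exact: continuous_phi].
have [dG GE] := @continuous_FTC1 R g -oo%O x (x + 1) xx1
  (integrable_g (measurable_itv _)) (ltNyr x) cg.
by rewrite -GE derive1E; exact: derivableP.
Qed.

(** Since [g] has total integral 0, [G x] is also minus the integral of [g] over the right
    half-line; the half-line not containing the origin in its interior gives a Gaussian tail. *)
Let G_ub x : `|G x| <= 2 * phi x / (1 + `|x|).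
Proof.
have le_g A : measurable A -> `|\int[mu]_(y in A) g y| <= \int[mu]_(y in A) phi y.
  move=> mA; apply: le_trans (le_normr_Rintegral mA (integrable_g mA)) _.
  apply: le_Rintegral => //; last exact: integrable_phi.
  exact/integrable_norm/integrable_g.
have [x0|/ltW x0] := leP 0 x.
  have GE : G x = - \int[mu]_(y in `]x, +oo[) g y.
    rewrite -(@Rintegral_itvB R g -oo%O +oo%O x)//; last exact: integrable_g.
    by rewrite set_itvNyy integral_g sub0r opprK.
  by rewrite GE normrN (ger0_norm x0) (le_trans (le_g _ _))// phi_tail.
by rewrite (ler0_norm x0) (le_trans (le_g _ _))// phi_tailN.
Qed.

(** The solution is [G / phi]: because [phi' = - x * phi], the quotient rule produces the equation.
    The tail bound on [G] gives [(1 + |x|) * |f x| <= 2], hence both estimates. *)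
Lemma stein_solution : exists f : R -> R, [/\
  forall x, is_derive x 1 f (x * f x + (h x - gauss_mean)),
  forall x, `|f x| <= 2 & forall x, `|x * f x| <= 2].
Proof.
have f_ub x : (1 + `|x|) * `|G x / phi x| <= 2.
  have phi0 := phi_gt0 x; have x0 := normr_ge0 x.
  rewrite normrM normfV [`|phi x|]gtr0_norm// mulrA ler_pdivrMr// mulrC.
  by rewrite -ler_pdivlMr; [exact: G_ub|lra].
exists (fun x => G x / phi x); split=> x.
- have phi0 : phi x != 0 by rewrite gt_eqF// phi_gt0.
  have dG := is_derive_G x.
  have dphiV := is_deriveV phi0 (is_derive_phi x).
  apply: is_derive_eq; rewrite /GRing.scale/= /g.
  by field.
- apply: le_trans (f_ub x); rewrite ler_peMl//.
  by have := normr_ge0 x; lra.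
- apply: le_trans (f_ub x); rewrite normrM ler_wpM2r//.
  by have := normr_ge0 x; lra.
Qed.

(** Here [h] lies below the indicator of []-oo, t]]. With [gauss_mean_ge], this compares means of
    ramps with the normal distribution function. *)
Lemma gauss_mean_le t : (forall x, t < x -> h x = 0) ->
  ((gauss_mean)%:E <= normal_prob 0 1 `]-oo, t])%E.
Proof.
move=> ht; rewrite /normal_prob -[leRHS]fineK; last first.
  by apply: integrable_fin_num => //; exact: integrable_phi.
rewrite lee_fin -/(Rintegral mu `]-oo, t] phi).
rewrite Rintegral_mkcond; apply: le_Rintegral => //.
- exact: integrable_hphi.
- by rewrite -restrict_EFin; apply/integrable_restrict => //; rewrite setTI; exact: integrable_phi.
move=> y _; rewrite patchE; case: ifPn => [_|].
  by have /andP[h0 h1] := h01 y; rewrite ler_piMl ?normal_pdf_ge0.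
by rewrite notin_setE/= in_itv/= => /negP; rewrite -ltNge => /ht ->; rewrite mul0r.
Qed.

Lemma gauss_mean_ge t : (forall x, x <= t -> h x = 1) ->
  (normal_prob 0 1 `]-oo, t] <= (gauss_mean)%:E)%E.
Proof.
move=> ht; rewrite /normal_prob -[leLHS]fineK; last first.
  by apply: integrable_fin_num => //; exact: integrable_phi.
rewrite lee_fin -/(Rintegral mu `]-oo, t] phi).
rewrite Rintegral_mkcond; apply: le_Rintegral => //.
- by rewrite -restrict_EFin; apply/integrable_restrict => //; rewrite setTI; exact: integrable_phi.
- exact: integrable_hphi.
move=> y _; rewrite patchE; case: ifPn => [|_].
  by rewrite inE/= in_itv/= => /ht ->; rewrite mul1r.
by have /andP[h0 h1] := h01 y; rewrite mulr_ge0 ?normal_pdf_ge0.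
Qed.

End solution.

End stein_equation.

(** * Product Bernoulli measures *)

Section bernoulli_product.
Context {R : realType} (I : finType) (p : R).
Local Notation config := {ffun I -> bool}.
Implicit Types (x : config) (F : config -> R).

(** Expectations under the product measure are handled as finite weighted sums;
    [erdos_renyi_expectation] links them to the integral. *)
Definition bern_weight x : R := \prod_i (if x i then p else 1 - p).

Definition bern_mean F : R := \sum_x bern_weight x * F x.

Local Notation Ex := bern_mean.

Lemma bern_mean_prod (g : I -> bool -> R) :
  Ex (fun x => \prod_i g i (x i)) =
  \prod_i (p * g i true + (1 - p) * g i false).
Proof.
transitivity (\prod_i \sum_(b : bool) (if b then p else 1 - p) * g i b).
  rewrite bigA_distr_bigA; apply: eq_bigr => x _.
  by rewrite /bern_weight big_split.
by apply: eq_bigr => i _; rewrite big_bool.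
Qed.

Lemma bern_mean_cst c : Ex (fun=> c) = c.
Proof.
have := bern_mean_prod (fun _ _ => 1).
rewrite [RHS]big1 => [|i _]; last by rewrite !mulr1 subrKC.
by rewrite /Ex big1_eq -!mulr_suml mulr1 => ->; rewrite mul1r.
Qed.

Lemma eq_bern_mean F1 F2 : F1 =1 F2 -> Ex F1 = Ex F2.
Proof. by move=> F12; apply: eq_bigr => x _; rewrite F12. Qed.

Lemma bern_meanD F1 F2 : Ex (fun x => F1 x + F2 x) = Ex F1 + Ex F2.
Proof. by rewrite /Ex -big_split; apply: eq_bigr => x _; rewrite mulrDr. Qed.

Lemma bern_meanZ c F : Ex (fun x => c * F x) = c * Ex F.
Proof. by rewrite /Ex mulr_sumr; apply: eq_bigr => x _; rewrite mulrCA. Qed.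

Lemma bern_meanB F1 F2 : Ex (fun x => F1 x - F2 x) = Ex F1 - Ex F2.
Proof. by rewrite /Ex -sumrB; apply: eq_bigr => x _; rewrite mulrBr. Qed.

Lemma bern_mean_sum (J : finType) (P : pred J) (F : J -> config -> R) :
  Ex (fun x => \sum_(j | P j) F j x) = \sum_(j | P j) Ex (F j).
Proof.
by rewrite /Ex exchange_big/=; apply: eq_bigr => x _; rewrite mulr_sumr.
Qed.

Definition set_coord x i b : config := [ffun j => if j == i then b else x j].

Let flip i x := set_coord x i (~~ x i).

Let flipK i : involutive (flip i).
Proof.
move=> x; apply/ffunP => j; rewrite !ffunE eqxx negbK.
by case: eqP => // ->.
Qed.

Let set_coord_flip i x b : set_coord (flip i x) i b = set_coord x i b.
Proof. by apply/ffunP => j; rewrite !ffunE; case: eqP. Qed.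

Lemma set_coord_id x i : set_coord x i (x i) = x.
Proof. by apply/ffunP => j; rewrite !ffunE; case: eqP => // ->. Qed.

(** Flipping coordinate [i] is an involution, so twice a mean is a sum over pairs [x], [flip i x].
    On such a pair both sides agree, because the resampled values coincide and the two weights at
    [i] add up to 1. *)
Lemma bern_mean_resample i F :
  Ex F = Ex (fun x => p * F (set_coord x i true) + (1 - p) * F (set_coord x i false)).
Proof.
pose w' x := \prod_(j | j != i) (if x j then p else 1 - p).
have wE x : bern_weight x = (if x i then p else 1 - p) * w' x.
  by rewrite /bern_weight (bigD1 i).
have w'flip x : w' (flip i x) = w' x.
  by apply: eq_bigr => j /negPf ji; rewrite !ffunE ji.
have double G : Ex G + Ex G = \sum_x (bern_weight x * G x + bern_weight (flip i x) * G (flip i x)).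
  rewrite big_split/=; congr (_ + _).
  by rewrite /Ex (reindex_inj (inv_inj (flipK i))).
have half (a b : R) : a + a = b + b -> a = b by lra.
apply: half; rewrite !double; apply: eq_bigr => x _.
rewrite !set_coord_flip !wE w'flip !ffunE eqxx.
have -> : F x = F (set_coord x i (x i)) by rewrite set_coord_id.
by rewrite /flip; case: (x i) => /=; ring.
Qed.

(** Discrete integration by parts: a centred coordinate is traded for a difference operator. *)
Lemma bern_mean_center i F :
  Ex (fun x => ((x i)%:R - p) * F x) =
  p * (1 - p) * Ex (fun x => F (set_coord x i true) - F (set_coord x i false)).
Proof.
rewrite (bern_mean_resample i) -bern_meanZ; apply: eq_bern_mean => x.
by rewrite !ffunE eqxx/=; ring.
Qed.

(** Orthogonality: an index in exactly one of [S] and [T] contributes a factor of mean zero. *)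
Lemma bern_mean_center_prod (S T : {set I}) :
  Ex (fun x => (\prod_(i in S) ((x i)%:R - p)) * (\prod_(i in T) ((x i)%:R - p)))
  = if S == T then (p * (1 - p)) ^+ #|S| else 0.
Proof.
pose g i (b : bool) : R :=
  (if i \in S then b%:R - p else 1) * (if i \in T then b%:R - p else 1).
rewrite (eq_bern_mean (F2 := fun x => \prod_i g i (x i))); last first.
  by move=> x; rewrite big_split/= -!big_mkcond.
rewrite bern_mean_prod.
have [eqST|neqST] := eqVneq S T.
  rewrite -prodr_const [RHS]big_mkcond; apply: eq_bigr => i _.
  by rewrite /g -eqST; case: ifP => _ /=; ring.
have [i iST] : exists i, (i \in S) (+) (i \in T).
  apply/existsP; apply: contraR neqST; rewrite negb_exists => /forallP h.
  by apply/eqP/setP => i; apply/eqP; have := h i; rewrite -addbN; case: (i \in S); case: (i \in T).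
rewrite (bigD1 i)//= /g.
by move: iST; case: (i \in S); case: (i \in T) => // _ /=; ring.
Qed.

Hypothesis p01 : 0 <= p <= 1.

Lemma bern_weight_ge0 x : 0 <= bern_weight x.
Proof.
by apply: prodr_ge0 => i _; case/andP: p01 => p0 p1; case: ifP => _; lra.
Qed.

Lemma bern_mean_le F1 F2 : (forall x, F1 x <= F2 x) -> Ex F1 <= Ex F2.
Proof.
by move=> F12; apply: ler_sum => x _; rewrite ler_wpM2l// bern_weight_ge0.
Qed.

Lemma bern_mean_norm F : `|Ex F| <= Ex (fun x => `|F x|).
Proof.
apply: le_trans (ler_norm_sum _ _ _) _; apply: ler_sum => x _.
by rewrite normrM (ger0_norm (bern_weight_ge0 x)).
Qed.

Lemma bern_mean_norm_sqrt F : Ex (fun x => `|F x|) <= Num.sqrt (Ex (fun x => F x ^+ 2)).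
Proof.
set m := Ex (fun x => `|F x|).
have m0 : 0 <= m by rewrite -(bern_mean_cst 0); apply: bern_mean_le => x.
rewrite -(ger0_norm m0) -sqrtr_sqr ler_wsqrtr// -subr_ge0.
(* The difference is the variance of [|F|]. *)
rewrite (_ : _ - _ = Ex (fun x => (`|F x| - m) ^+ 2)).
  by rewrite -(bern_mean_cst 0); apply: bern_mean_le => x; exact: sqr_ge0.
rewrite [RHS](eq_bern_mean (F2 := fun x => F x ^+ 2 - (2 * m * `|F x| - m ^+ 2))).
  by rewrite !bern_meanB bern_meanZ bern_mean_cst -/m; ring.
by move=> x; rewrite sqrrB real_normK ?num_real//; ring.
Qed.

End bernoulli_product.

(** * Normal approximation of a Bernoulli sum by Stein's method *)

Section bernoulli_clt.
Context {R : realType}.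
Implicit Types (f h k : R -> R).

Definition lipschitz_on_line (L : R) f := forall x y, `|f x - f y| <= L * `|x - y|.

Lemma derive_MVT f (df : R -> R) (a b : R) : a < b ->
  (forall x : R, is_derive x 1 f (df x)) ->
  exists2 c, a < c < b & f b - f a = df c * (b - a).
Proof.
move=> ab fdf; have [|c + eq] := MVT ab (fun x _ => fdf x).
  apply: continuous_subspaceT => x.
  exact/differentiable_continuous/derivable1_diffP/(@ex_derive _ _ _ _ _ _ _ (fdf x)).
by rewrite in_itv/=; exists c.
Qed.

Lemma bounded_derive_lipschitz f (df : R -> R) L :
  (forall x : R, is_derive x 1 f (df x)) -> (forall x, `|df x| <= L) ->
  lipschitz_on_line L f.
Proof.
move=> fdf dfL.
have lt_case x y : x < y -> `|f x - f y| <= L * `|x - y|.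
  move=> xy; have [c _ eq] := derive_MVT xy fdf.
  by rewrite distrC eq normrM [`|x - y|]distrC ler_wpM2r.
move=> x y; have [xy|xy|->] := ltgtP x y; first exact: lt_case.
  by rewrite distrC [`|x - y|]distrC; exact: lt_case.
by rewrite !subrr normr0 mulr0.
Qed.

Context (I : finType) (p : R).
Hypothesis p01 : 0 < p < 1.
Hypothesis I0 : (0 < #|I|)%N.
Local Notation config := {ffun I -> bool}.
Local Notation Ex := (bern_mean (I := I) p).

Definition bern_sd : R := Num.sqrt (#|I|%:R * p * (1 - p)).

Definition bern_std (x : config) : R := (\sum_i ((x i)%:R - p)) / bern_sd.

Local Notation s := bern_sd.
Local Notation W := bern_std.

Let p01W : 0 <= p <= 1.
Proof. by case/andP: p01 => p0 p1; rewrite !ltW. Qed.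

Lemma bern_sd_gt0 : 0 < s.
Proof.
by case/andP: p01 => p0 p1; rewrite sqrtr_gt0 !mulr_gt0 ?ltr0n// subr_gt0.
Qed.

Let sd2 : s ^+ 2 = #|I|%:R * p * (1 - p).
Proof.
by case/andP: p01 => p0 p1; rewrite sqr_sqrtr// !mulr_ge0 ?subr_ge0 ?ler0n// ltW.
Qed.

Let bern_std_set_true x i : W (set_coord x i true) = W (set_coord x i false) + s^-1.
Proof.
rewrite /W (bigD1 i)//= [in RHS](bigD1 i)//= !ffunE eqxx/=.
rewrite (eq_bigr (fun j => (x j)%:R - p)) => [|j /negPf ji]; last by rewrite ffunE ji.
rewrite [in RHS](eq_bigr (fun j => (x j)%:R - p)) => [|j /negPf ji]; last by rewrite ffunE ji.
by have := bern_sd_gt0 => s0; field; rewrite gt_eqF.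
Qed.

(** Integration by parts in every coordinate; this is the discrete analogue of the Gaussian identity
    E[W f(W)] = E[f'(W)]. *)
Lemma bern_mean_std_mul f :
  Ex (fun x => W x * f (W x)) = p * (1 - p) / s *
    \sum_i Ex (fun x => f (W (set_coord x i true)) - f (W (set_coord x i false))).
Proof.
rewrite (eq_bern_mean _ (F2 := fun x => s^-1 * \sum_i ((x i)%:R - p) * f (W x))); last first.
  by move=> x; rewrite {1}/W mulrAC -mulr_suml mulrC.
rewrite bern_meanZ bern_mean_sum mulr_sumr [RHS]mulr_sumr.
by apply: eq_bigr => i _; rewrite (bern_mean_center _ i (fun x => f (W x))); ring.
Qed.

(** The weights total 1 because [s ^+ 2] is the variance of the sum. A constant can thus be spread
    over the coordinates and compared term by term. *)
Let sum_coord_weight (c : R) : p * (1 - p) / s * (\sum_(i : I) s^-1 * c) = c.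
Proof.
have s0 : s != 0 by rewrite gt_eqF// bern_sd_gt0.
rewrite sumr_const -mulr_natl.
transitivity (#|I|%:R * p * (1 - p) / s ^+ 2 * c); first by field.
by rewrite -sd2 divff ?mul1r// expf_neq0.
Qed.

Lemma bern_mean_std_sqr : Ex (fun x => W x ^+ 2) = 1.
Proof.
rewrite (eq_bern_mean _ (F2 := fun x => W x * id (W x)))//.
rewrite (bern_mean_std_mul id) -[RHS](sum_coord_weight 1); congr (_ * _).
apply: eq_bigr => i _; rewrite mulr1 -[RHS](bern_mean_cst I p).
by apply: eq_bern_mean => x; rewrite bern_std_set_true addrAC subrr add0r.
Qed.

Lemma bern_mean_std_norm : Ex (fun x => `|W x|) <= 1.
Proof.
by apply: le_trans (bern_mean_norm_sqrt p01W _) _; rewrite bern_mean_std_sqr sqrtr1.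
Qed.

(* Resampling coordinate i turns E[W f(W)] into a difference quotient of f with
   step 1/s, and f' varies by O((1 + |W|) / s) over such a step. *)
Lemma stein_bound f k (C L : R) : 0 <= C -> 0 <= L ->
  (forall x : R, is_derive x 1 f (x * f x + k x)) ->
  (forall x, `|f x| <= C) -> (forall x, `|x * f x| <= C) ->
  (forall x, `|k x| <= 1) -> lipschitz_on_line L k ->
  `|Ex (fun x => k (W x))| <= (C + L + (C + 1)) / s.
Proof.
move=> C0 L0 fdf fC xfC k1 kL.
have s0 := bern_sd_gt0.
have flip : lipschitz_on_line (C + 1) f.
  apply: (bounded_derive_lipschitz fdf) => x.
  by apply: le_trans (ler_normD _ _) _; exact: lerD.
pose u x := x * f x + k x.
have step i x : `|s * (f (W (set_coord x i true)) - f (W (set_coord x i false))) - u (W x)|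
    <= (C + L + (C + 1) * `|W x|) / s.
  have s1 : 0 < s^-1 by rewrite invr_gt0.
  set w0 := W (set_coord x i false); set w1 := W (set_coord x i true).
  have w01 : w1 = w0 + s^-1 by exact: bern_std_set_true.
  have lt01 : w0 < w1 by lra.
  have [c /andP[w0c cw1] ->] := derive_MVT lt01 fdf.
  have -> : w1 - w0 = s^-1 by rewrite w01; ring.
  rewrite mulrCA mulfV ?gt_eqF// mulr1 -/(u c).
  (* [W x] is one of the two endpoints [w0], [w1], according to [x i]. *)
  have cW : `|c - W x| <= s^-1.
    have : W x = w0 \/ W x = w1.
      rewrite /w0 /w1 -(set_coord_id x i); case: (x i); [right|left];
        by congr W; apply/ffunP => j; rewrite !ffunE; case: eqP.
    by case=> ->; rewrite ler_norml; apply/andP; split; lra.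
  have -> : u c - u (W x) = (c - W x) * f c + W x * (f c - f (W x)) + (k c - k (W x)).
    by rewrite /u; ring.
  apply: le_trans (ler_normD _ _) _.
  apply: le_trans (lerD (ler_normD _ _) (lexx _)) _.
  rewrite (normrM (c - W x)) (normrM (W x)).
  have t1 : `|c - W x| * `|f c| <= s^-1 * C by rewrite ler_pM.
  have t2 : `|W x| * `|f c - f (W x)| <= `|W x| * ((C + 1) * s^-1).
    by rewrite ler_wpM2l// (le_trans (flip _ _))// ler_wpM2l//; lra.
  have t3 : `|k c - k (W x)| <= L * s^-1 by rewrite (le_trans (kL _ _))// ler_wpM2l.
  have -> : (C + L + (C + 1) * `|W x|) / s
      = s^-1 * C + `|W x| * ((C + 1) * s^-1) + L * s^-1 by ring.
  exact: lerD (lerD t1 t2) t3.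
(* Stein's equation, with [u] the derivative of [f]. The mean of [W * f W] becomes a sum of
   differences, and [u (W x)] is spread over the same coordinates. *)
have kE x : k (W x) = u (W x) - W x * f (W x) by rewrite /u; ring.
rewrite (eq_bern_mean _ kE) bern_meanB bern_mean_std_mul.
rewrite -[X in X - _]sum_coord_weight -mulrBr -sumrB.
rewrite normrM ger0_norm; last first.
  by case/andP: p01 => p0 p1; rewrite divr_ge0 ?mulr_ge0//; lra.
rewrite -[leRHS]sum_coord_weight ler_wpM2l//.
  by case/andP: p01 => p0 p1; rewrite divr_ge0 ?mulr_ge0//; lra.
apply: le_trans (ler_norm_sum _ _ _) _; apply: ler_sum => i _.
rewrite -bern_meanZ -bern_meanB.
apply: le_trans (bern_mean_norm p01W _) _.
apply: (@le_trans _ _ (Ex (fun x => s^-1 * ((C + L + (C + 1) * `|W x|) / s)))).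
  apply: bern_mean_le => // x; rewrite distrC.
  set D := f _ - f _.
  have -> : D - s^-1 * u (W x) = s^-1 * (s * D - u (W x)).
    by field; rewrite gt_eqF.
  by rewrite normrM gtr0_norm ?invr_gt0// ler_wpM2l ?invr_ge0 ?(ltW s0)//; exact: step.
rewrite bern_meanZ ler_wpM2l ?invr_ge0 ?(ltW s0)//.
rewrite (eq_bern_mean _ (F2 := fun x => s^-1 * (C + L - - ((C + 1) * `|W x|)))); last first.
  by move=> x; ring.
rewrite bern_meanZ bern_meanB bern_mean_cst [leRHS]mulrC ler_wpM2l ?invr_ge0 ?(ltW s0)//.
rewrite (eq_bern_mean _ (F2 := fun x => (- (C + 1)) * `|W x|)); last first.
  by move=> x; ring.
rewrite bern_meanZ mulNr opprK lerD2l -[leRHS]mulr1 ler_wpM2l ?bern_mean_std_norm//; lra.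
Qed.

End bernoulli_clt.

(** * Counting embeddings *)

Lemma prodrD_subset {R : comRingType} (I : finType) (E : {set I}) (Y : I -> R) (c : R) :
  \prod_(e in E) (Y e + c) =
  \sum_(A : {set I} | A \subset E) c ^+ (#|E| - #|A|) * \prod_(e in A) Y e.
Proof.
(* Factors outside [E] are written [0 + 1], so the expansion over all subsets keeps only those
   contained in [E]. *)
transitivity (\prod_e ((if e \in E then Y e else 0) + (if e \in E then c else 1))).
  by rewrite big_mkcond; apply: eq_bigr => e _; case: ifP => // _; rewrite add0r.
rewrite bigA_distr [RHS]big_mkcond; apply: eq_bigr => A _; case: ifPn => [AE|].
  rewrite -cardsDS// -prodr_const [X in _ = X * _]big_mkcond [X in _ = _ * X]big_mkcond.
  rewrite -big_split/=.
  apply: eq_bigr => e _; rewrite inE.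
  have [/(fintype.subsetP AE) ->|_] := boolP (e \in A); first by rewrite mul1r.
  by case: ifP => _; rewrite mulr1.
case/subsetPn => e eA eE; rewrite (bigD1 e)//= eA (negPf eE) mul0r//.
Qed.

Lemma card_edge_val (V : finType) (e : edge V) : #|val e| = 2%N.
Proof. exact/eqP/(valP e). Qed.

Lemma card_edge n : #|{: edge 'I_n}| = 'C(n, 2).
Proof. by rewrite card_sig -[in RHS](card_ord n) -card_draws cardsE. Qed.

Section injections.
Context (V W : finType).
Implicit Types (f g : injection V W) (e : edge V) (A : {set edge V}).

Lemma card_injection : #|{: injection V W}| = #|W| ^_ #|V|.
Proof. by rewrite card_sig -card_inj_ffuns cardsE. Qed.

Lemma injection_inj f : injective (val f).
Proof. exact/injectiveP/(valP f). Qed.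

Lemma edge_imset_inj f : injective (edge_imset f).
Proof.
by move=> e1 e2 /(congr1 val)/= /(imset_inj (@injection_inj f)); exact: val_inj.
Qed.

Lemma permute_injection_subproof (s : {perm W}) f :
  injectiveb [ffun v => s (val f v)].
Proof.
by apply/injectiveP => v w; rewrite !ffunE => /perm_inj; exact: injection_inj.
Qed.

Definition permute_injection (s : {perm W}) f : injection V W :=
  Sub [ffun v => s (val f v)] (permute_injection_subproof s f).

Lemma permute_injection_inj s : injective (permute_injection s).
Proof.
move=> f g /(congr1 val)/ffunP fg; apply/val_inj/ffunP => v.
by have := fg v; rewrite !ffunE => /perm_inj.
Qed.

Lemma edge_transitive (i j : edge W) : exists s : {perm W}, [set s w | w in val i]%SET = val j.
Proof.
have /cards2P[a [b [ab ->]]] := valP i.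
have /cards2P[c [d [cd ->]]] := valP j.
(* The first transposition sends [a] to [c] and [b] to [b'], which differs from [c]; the second
   sends [b'] to [d] and fixes [c]. *)
pose b' := tperm a c b; exists (tperm a c * tperm b' d)%g.
have b'c : b' != c by rewrite -(tpermL a c) (inj_eq perm_inj) eq_sym.
rewrite imsetU1 imset_set1 !permM tpermL -/b' tpermL tpermD//.
by rewrite eq_sym.
Qed.

(** Composing with a permutation that carries one edge to the other maps one fibre injectively into
    the other, in both directions. *)
Lemma card_injection_edge_const e (i j : edge W) :
  (#|[set f | edge_imset f e == i]%SET| = #|[set f | edge_imset f e == j]%SET|)%N.
Proof.
have le (i' j' : edge W) : (#|[set f | edge_imset f e == i']%SET| <=
                 #|[set f | edge_imset f e == j']%SET|)%N.
  have [s sij] := edge_transitive i' j'.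
  rewrite -(card_imset _ (@permute_injection_inj s)).
  apply/subset_leq_card/fintype.subsetP => _ /imsetP[f + ->]; rewrite !inE => /eqP fe.
  apply/eqP/val_inj; rewrite -sij -fe /= -imset_comp.
  by apply: eq_imset => v; rewrite /= ffunE.
by apply/eqP; rewrite eqn_leq !le.
Qed.

End injections.

(* By symmetry all edges of the complete graph have equally many preimages, so
   it suffices to divide the number of embeddings by the number of edges. *)
Lemma card_injection_edge (V : finType) n (e : edge V) (i : edge 'I_n) :
  (#|[set f : injection V 'I_n | edge_imset f e == i]%SET| = 2 * (n - 2) ^_ (#|V| - 2))%N.
Proof.
have n2 : (2 <= n)%N. by rewrite -[n]card_ord -(card_edge_val i) max_card.
have V2 : (2 <= #|V|)%N by rewrite -(card_edge_val e) max_card.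
have total : ('C(n, 2) * #|[set f : injection V 'I_n | edge_imset f e == i]%SET| = n ^_ #|V|)%N.
  rewrite -[in RHS](card_ord n) -card_injection -[RHS]sum1_card.
  rewrite [RHS](partition_big (fun f => edge_imset f e) xpredT)//=.
  rewrite -card_edge -sum_nat_const; apply: eq_big => // j _.
  by rewrite (card_injection_edge_const e i j) -sum1_card; apply: eq_bigl => f; rewrite inE.
have C0 : (0 < 'C(n, 2))%N by rewrite bin_gt0.
apply/eqP; rewrite -(eqn_pmul2l C0) total mulnA; apply/eqP.
move: n2 V2 {i total C0}; case: n => [//|[//|m]] _; case: #|V| => [//|[//|k]] _.
rewrite !ffactSS !subn2/= !mulnA; congr (_ * _)%N.
by have := bin_ffact m.+2 2; rewrite !ffactSS ffactn0 muln1.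
Qed.

(** * Pairs of embeddings with the same image *)

Section overlaps.
Context (V : finType) (n : nat).
Implicit Types (f g : injection V 'I_n) (A : {set edge V}).

(** The vertex set of the smallest subgraph with edge set [A], hence the one with the largest ratio
    in [dprime]. *)
Definition edge_cover A : {set V} := \bigcup_(e in A) val e.

(** If the images of [A] agree, [g] sends covered vertices into the image of the cover under [f],
    leaving at most [#|U|] choices for each; every other vertex has at most [n]. *)
Lemma card_same_image A f :
  (#|[set g | (edge_imset f @: A == edge_imset g @: A)%SET]%SET|
     <= #|V| ^ #|V| * n ^ (#|V| - #|edge_cover A|))%N.
Proof.
set U := edge_cover A.
pose F v : pred 'I_n := fun i => (v \in U) ==> (i \in [set val f u | u in U]%SET).
rewrite -(card_imset _ val_inj).
apply: (@leq_trans #|(family F : simpl_pred {ffun V -> 'I_n})|).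
  apply/subset_leq_card/fintype.subsetP => _ /imsetP[g + ->]; rewrite inE => /eqP fgA.
  apply/familyP => v; apply/implyP => /bigcupP[e eA ve].
  have : edge_imset g e \in edge_imset f @: A by rewrite fgA imset_f.
  case/imsetP => e' e'A /(congr1 val)/= ge.
  have : val g v \in [set val g v | v in val e]%SET by rewrite imset_f.
  rewrite ge => /imsetP[u ue' ->]; apply: imset_f.
  by apply/bigcupP; exists e'.
rewrite card_family foldrE big_map big_enum/=.
rewrite (eq_bigr (fun v => if v \in U then #|U| else n)) => [|v _]; last first.
  case: ifPn => vU; last by rewrite -[RHS]card_ord; apply: eq_card => i; rewrite !inE /F (negPf vU).
  by rewrite -(card_imset U (@injection_inj _ _ f)); apply: eq_card => i; rewrite -topredE/= /F vU.
rewrite (bigID (mem U))/=.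
rewrite (eq_bigr (fun=> #|U|)) => [|v ->//].
rewrite [X in (_ * X)%N](eq_bigr (fun=> n)) => [|v /negPf ->//].
rewrite !prod_nat_const leq_mul//.
  (* Monotonicity of powers in the base requires a positive exponent. *)
  case: (posnP #|U|) => [->|U0]; first by rewrite expn0 expn_gt0; case: #|V|.
  apply: (@leq_trans (#|V| ^ #|U|)%N); first by rewrite leq_exp2r// max_card.
  by rewrite leq_pexp2l ?max_card// (leq_trans U0)// max_card.
by rewrite -[X in (X - _)%N](cardC (mem U)) addKn.
Qed.

End overlaps.

(** * Hoeffding decomposition of the number of copies *)

Section hoeffding.
Context {R : realType} (V : finType) (E : {set edge V}) (n : nat) (p : R).
Local Notation config := {ffun edge 'I_n -> bool}.
Implicit Types (x : config) (A : {set edge V}).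
Local Notation Ex := (bern_mean (I := edge 'I_n) p).

Definition copies x : R :=
  \sum_(f : injection V 'I_n) \prod_(e in E) (x (edge_imset f e))%:R.

Definition hoeffding_term A x : R :=
  \sum_(f : injection V 'I_n) \prod_(e in A) ((x (edge_imset f e))%:R - p).

Lemma copiesE x : copies x =
  \sum_(A : {set edge V} | A \subset E) p ^+ (#|E| - #|A|) * hoeffding_term A x.
Proof.
rewrite /copies; under [RHS]eq_bigr do rewrite mulr_sumr.
rewrite exchange_big/=; apply: eq_bigr => f _.
rewrite -(prodrD_subset E (fun e => (x (edge_imset f e))%:R - p)).
by apply: eq_bigr => e _; rewrite subrK.
Qed.

(** Indexing by edges of the complete graph puts each summand in the form required by
    [bern_mean_center_prod]. *)
Lemma hoeffding_term_imset A x : hoeffding_term A x =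
  \sum_(f : injection V 'I_n)
    \prod_(i in [set edge_imset f e | e in A]%SET) ((x i)%:R - p).
Proof.
apply: eq_bigr => f _; rewrite big_imset// => e1 e2 _ _.
exact: edge_imset_inj.
Qed.

Lemma bern_mean_hoeffding_term A : A != finset.set0 -> Ex (hoeffding_term A) = 0.
Proof.
move=> A0; rewrite (eq_bern_mean _ (hoeffding_term_imset A)) bern_mean_sum big1// => f _.
have := bern_mean_center_prod p (edge_imset f @: A)%SET finset.set0.
rewrite imset_eq0 (negPf A0) => <-; apply: eq_bern_mean => x.
by rewrite big_set0 mulr1.
Qed.

Lemma bern_mean_hoeffding_term_sqr A : Ex (fun x => hoeffding_term A x ^+ 2) =
  (\sum_(f : injection V 'I_n) #|[set g : injection V 'I_n |
      (edge_imset f @: A == edge_imset g @: A)%SET]%SET|)%:R * (p * (1 - p)) ^+ #|A|.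
Proof.
under eq_bern_mean => x do rewrite hoeffding_term_imset expr2 mulr_suml.
rewrite bern_mean_sum natr_sum mulr_suml; apply: eq_bigr => f _.
under eq_bern_mean => x do rewrite mulr_sumr.
rewrite bern_mean_sum -sumr_const mulr_suml [RHS]big_mkcond/=; apply: eq_bigr => g _.
rewrite bern_mean_center_prod inE card_imset; last exact: edge_imset_inj.
by case: ifP; rewrite ?mul1r.
Qed.

(** Embeddings are grouped by the image of [e]; all groups have the size given by
    [card_injection_edge]. *)
Lemma hoeffding_term1 e x : hoeffding_term [set e]%SET x =
  2 * ((n - 2) ^_ (#|V| - 2))%:R * \sum_i ((x i)%:R - p).
Proof.
rewrite /hoeffding_term; under eq_bigr do rewrite big_set1.
rewrite (partition_big (fun f => edge_imset f e) xpredT)//= mulr_sumr.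
apply: eq_bigr => i _; rewrite -natrM -(card_injection_edge e i) mulr_natl -sumr_const.
rewrite big_mkcond [RHS]big_mkcond; apply: eq_bigr => f _; rewrite inE.
by case: eqP => // ->.
Qed.

Definition hoeffding_rest x : R :=
  \sum_(A : {set edge V} | (A \subset E) && (2 <= #|A|)%N)
    p ^+ (#|E| - #|A|) * hoeffding_term A x.

Lemma centered_copies x : copies x - Ex copies =
  2 * #|E|%:R * ((n - 2) ^_ (#|V| - 2))%:R * p ^+ (#|E| - 1) * \sum_i ((x i)%:R - p)
  + hoeffding_rest x.
Proof.
have rest A : (A \subset E) && (A != finset.set0) =
    (A \subset E) && (#|A| == 1%N) || (A \subset E) && (2 <= #|A|)%N.
  by rewrite -andb_orr -cards_eq0; case: #|A| => [|[|k]].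
(* The term of the empty set does not depend on [x], and all others have mean zero. *)
have -> : Ex copies = p ^+ #|E| * hoeffding_term finset.set0 x.
  rewrite (eq_bern_mean _ copiesE) bern_mean_sum (bigD1 finset.set0) ?finset.sub0set//=.
  rewrite big1 => [|A /andP[_ A0]]; last by rewrite bern_meanZ bern_mean_hoeffding_term// mulr0.
  rewrite addr0 cards0 subn0 bern_meanZ; congr (_ * _).
  rewrite -[RHS](bern_mean_cst (edge 'I_n) p); apply: eq_bern_mean => y.
  by apply: eq_bigr => f _; rewrite !big_set0.
rewrite copiesE (bigD1 finset.set0) ?finset.sub0set//= cards0 subn0 addrAC subrr add0r.
rewrite (bigID (fun A => #|A| == 1%N))/=; congr (_ + _); last first.
  apply: eq_bigl => A; rewrite -andbA; congr (_ && _).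
  by rewrite -cards_eq0; case: #|A| => [|[|k]].
transitivity (\sum_(A in [set [set e] | e in E]%SET)
    p ^+ (#|E| - #|A|) * hoeffding_term A x).
  apply: eq_bigl => A; apply/idP/imsetP.
    move=> /andP[/andP[AE _] /cards1P[e eA]]; exists e => //.
    by apply: (fintype.subsetP AE); rewrite eA finset.set11.
  by case=> e eE ->; rewrite finset.sub1set eE cards1 eqxx -cards_eq0 cards1.
rewrite big_imset/=; last by move=> e1 e2 _ _; exact: finset.set1_inj.
under eq_bigr do rewrite cards1 hoeffding_term1.
rewrite sumr_const -[LHS]mulr_natl.
have assoc (a b c d : R) : a * (c * (2 * b * d)) = 2 * a * b * c * d by ring.
exact: assoc.
Qed.

End hoeffding.

(** * Second moment of the nonlinear part *)

(** No factor of the falling factorial is below [m.+1 - k]. *)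
Lemma ffact_ge c m k : (c + k <= m.+1 -> c ^ k <= m ^_ k)%N.
Proof.
elim: k m c => [|k IH] m c cm; first by rewrite ffactn0.
rewrite ffactnS expnS leq_mul//; first by lia.
by apply: IH; lia.
Qed.

(** * Covered vertices and the exponent d'(G) *)

Section edge_cover.
Context (R : realType) (V : finType) (E : {set edge V}).
Implicit Types A : {set edge V}.

Lemma sub_edge_cover A e : e \in A -> val e \subset edge_cover A.
Proof. by move=> eA; apply: (finset.bigcup_sup e). Qed.

(** If at most two vertices were covered, every edge of [A] would be the whole cover, and two
    distinct edges would coincide. *)
Lemma card_edge_cover_ge A : (2 <= #|A|)%N -> (3 <= #|edge_cover A|)%N.
Proof.
case/card_gt1P => e1 [e2 [e1A e2A]]; apply: contraNltn => cov2.
have full e : e \in A -> val e = edge_cover A.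
  by move=> eA; apply/eqP; rewrite eqEcard sub_edge_cover// card_edge_val.
by apply/eqP/val_inj; rewrite !full.
Qed.

Lemma dprime_ge A : A \subset E -> (2 <= #|A|)%N ->
  2 * #|A|%:R - 1 <= dprime R E * (#|edge_cover A|%:R - 2).
Proof.
move=> AE A2; have cov3 := card_edge_cover_ge A2.
have cov0 : 0 < #|edge_cover A|%:R - 2 :> R by rewrite subr_gt0 ltr_nat.
rewrite -ler_pdivrMr//.
have sub : is_subgraph E (edge_cover A, A) && (2 <= #|(edge_cover A, A).2|)%N.
  by rewrite /is_subgraph/= AE A2 andbT; apply/forall_inP => e; exact: sub_edge_cover.
rewrite /dprime.
by have := @le_bigmax_cond _ R _ 0 (edge_cover A, A)
  (fun H => is_subgraph E H && (2 <= #|H.2|)%N)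
  (fun H => (2 * #|H.2|%:R - 1) / (#|H.1|%:R - 2)) sub.
Qed.

(** As the left side is at least 1, it is at most its power [k = v - 2], with [v] the number of
    covered vertices. Then [dprime * k >= 2 |A| - 1 >= |A| - 1] and [p < 1] bound the power of
    [p]. *)
Lemma density_bound n (p : R) A : 0 < p < 1 -> A \subset E -> (2 <= #|A|)%N ->
  1 <= n%:R * p `^ dprime R E ->
  n%:R * p `^ dprime R E <= n%:R ^+ (#|edge_cover A| - 2) * p ^+ (#|A| - 1).
Proof.
case/andP=> p0 p1 AE A2 M1; set M := _ * _ in M1 *.
have cov3 := card_edge_cover_ge A2.
have dA := dprime_ge AE A2.
set k := (#|edge_cover A| - 2)%N.
have k1 : (1 <= k)%N by rewrite /k; lia.
apply: (@le_trans _ _ (M ^+ k)); first by rewrite ler_eXnr.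
rewrite exprMn ler_wpM2l ?exprn_ge0//.
rewrite -!powR_mulrn ?powR_ge0 ?(ltW p0)// -powRrM ger_powR ?p0 ?(ltW p1)//.
have -> : k%:R = #|edge_cover A|%:R - 2 :> R by rewrite natrB//; lia.
apply: le_trans dA; rewrite natrB; last by lia.
have : 2 <= #|A|%:R :> R by rewrite ler_nat.
lra.
Qed.

End edge_cover.

(** Powers of [n] in [hoeffding_term_bound]: [v] for the first embedding, [v - a] for the free
    vertices of the second, [a - 2] from [density_bound]. *)
Lemma vertex_exponent v a : (3 <= a)%N -> (a <= v)%N ->
  (2 * v - 2 = v + (v - a) + (a - 2))%N.
Proof. lia. Qed.

(** Powers of [p] likewise: twice [e - k] from the squared coefficient, [k] from the variances,
    [k - 1] from [density_bound]. *)
Lemma edge_exponent e k : (2 <= k)%N -> (k <= e)%N ->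
  (2 * e - 1 = (e - k) + (e - k) + k + (k - 1))%N.
Proof. lia. Qed.

Section remainder.
Context {R : realType} (V : finType) (E : {set edge V}) (n : nat) (p eps : R).
Hypothesis E2 : (2 <= #|E|)%N.
Hypothesis p01 : 0 < p < 1.
Hypothesis eps0 : 0 < eps.
Hypothesis peps : p <= 1 - eps.
Hypothesis nV : (2 * #|V| <= n)%N.
Hypothesis V3 : (3 <= #|V|)%N.
Local Notation Ex := (bern_mean (I := edge 'I_n) p).
Local Notation s := (bern_sd (edge 'I_n) p).
Local Notation M := (n%:R * p `^ dprime R E).
Hypothesis M1 : 1 <= M.

(** The denominator of the theorem without the factor [1 / |Aut(G)|], since [copies] counts
    embeddings. *)
Definition copies_scale : R :=
  2 * #|E|%:R * ((n - 2) ^_ (#|V| - 2))%:R * p ^+ (#|E| - 1) * s.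

(** The first factor comes from [card_same_image], the rest from [copies_scale_sqr_ge]. *)
Definition remainder_const : R := #|V|%:R ^+ #|V| * 4 ^+ (#|V| - 1) / eps.

Lemma bern_sd_sqr_ge : n%:R ^+ 2 / 4 * p * eps <= s ^+ 2.
Proof.
have /andP[p0 p1] := p01.
rewrite /bern_sd sqr_sqrtr ?mulr_ge0 ?subr_ge0 ?(ltW p0) ?(ltW p1)//.
rewrite card_edge ler_pM ?mulr_ge0 ?divr_ge0 ?(ltW p0) ?(ltW eps0) ?exprn_ge0//;
  last by move: peps; lra.
rewrite ler_wpM2r ?(ltW p0)// ler_pdivrMr// -natrX -natrM ler_nat.
have := bin_ffact n 2; rewrite !ffactnS ffactn0 muln1.
rewrite (_ : 2`! = 2)//; nia.
Qed.

Lemma copies_scale_sqr_ge :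
  n%:R ^+ (2 * #|V| - 2) * 4^-1 ^+ (#|V| - 1) * p ^+ (2 * #|E| - 1) * eps
    <= copies_scale ^+ 2.
Proof.
have /andP[p0 p1] := p01.
(* Each factor is at least [n - |V|], which is at least [n / 2] by [nV]. *)
have ff : (n%:R / 2) ^+ (#|V| - 2) <= ((n - 2) ^_ (#|V| - 2))%:R :> R.
  apply: (@le_trans _ _ ((n - #|V|) ^ (#|V| - 2))%:R); last first.
    by rewrite ler_nat ffact_ge//; lia.
  rewrite natrX lerXn2r ?nnegrE ?divr_ge0//.
  by rewrite ler_pdivrMr// -natrM ler_nat; lia.
have -> : n%:R ^+ (2 * #|V| - 2) * 4^-1 ^+ (#|V| - 1) * p ^+ (2 * #|E| - 1) * eps =
    ((n%:R / 2) ^+ (#|V| - 2) * p ^+ (#|E| - 1)) ^+ 2 * (n%:R ^+ 2 / 4 * p * eps) :> R.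
  have -> : (2 * #|V| - 2 = (#|V| - 2) * 2 + 2)%N by lia.
  have -> : (#|V| - 1 = (#|V| - 2) + 1)%N by lia.
  have -> : (2 * #|E| - 1 = (#|E| - 1) * 2 + 1)%N by lia.
  have -> : 4^-1 = 2^-1 ^+ 2 :> R by field.
  rewrite !exprD !exprM !expr1 -[(2^-1 ^+ 2) ^+ (#|V| - 2)]exprM mulnC exprM.
  rewrite [(n%:R / 2) ^+ _]exprMn.
  have regroup (a b q x h : R) : a ^+ 2 * x ^+ 2 * (b ^+ 2 * h ^+ 2) * (q ^+ 2 * p) * eps =
    (a * b * q) ^+ 2 * (x ^+ 2 * h ^+ 2 * p * eps) by ring.
  exact: regroup.
have -> : copies_scale ^+ 2 = (((n - 2) ^_ (#|V| - 2))%:R * p ^+ (#|E| - 1)) ^+ 2 *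
    ((2 * #|E|%:R) ^+ 2 * s ^+ 2).
  have regroup (a f q t : R) : (2 * a * f * q * t) ^+ 2 =
    (f * q) ^+ 2 * ((2 * a) ^+ 2 * t ^+ 2) by ring.
  exact: regroup.
apply: ler_pM.
- exact: sqr_ge0.
- by rewrite !mulr_ge0 ?divr_ge0 ?exprn_ge0 ?(ltW p0) ?(ltW eps0).
- rewrite lerXn2r ?nnegrE ?mulr_ge0 ?exprn_ge0 ?divr_ge0 ?(ltW p0)//.
  by rewrite ler_wpM2r ?exprn_ge0 ?(ltW p0).
- apply: le_trans bern_sd_sqr_ge _; rewrite ler_peMl ?sqr_ge0//.
  rewrite -natrM -natrX ler1n; nia.
Qed.

(** The count of overlapping pairs is divided by the lower bound for the squared scale; what remains
    in [n] and [p] is the reciprocal of the right side of [density_bound]. *)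
Lemma hoeffding_term_bound (A : {set edge V}) : A \subset E -> (2 <= #|A|)%N ->
  Ex (fun x => (p ^+ (#|E| - #|A|) * hoeffding_term p A x / copies_scale) ^+ 2)
    <= remainder_const / M.
Proof.
move=> AE A2; have /andP[p0 p1] := p01.
have M0 : 0 < M by exact: lt_le_trans M1.
have pq0 : 0 <= p * (1 - p) by rewrite mulr_ge0 ?subr_ge0 ?ltW.
have pqp : p * (1 - p) <= p by rewrite ler_piMr ?(ltW p0)// lerBlDr lerDl ltW.
have AleE := subset_leq_card AE.
have covV : (#|edge_cover A| <= #|V|)%N by exact: max_card.
have cov3 := card_edge_cover_ge A2.
have n0 : 0 < n%:R :> R by rewrite ltr0n (leq_trans _ nV)// muln_gt0 (leq_trans _ V3).
set low := n%:R ^+ (2 * #|V| - 2) * 4^-1 ^+ (#|V| - 1) * p ^+ (2 * #|E| - 1) * eps.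
have low0 : 0 < low by rewrite !mulr_gt0 ?exprn_gt0 ?invr_gt0.
rewrite (eq_bern_mean _ (F2 := fun x =>
    (p ^+ (#|E| - #|A|)) ^+ 2 / copies_scale ^+ 2 * hoeffding_term p A x ^+ 2)); last first.
  have sq (c z d : R) : (c * z / d) ^+ 2 = c ^+ 2 / d ^+ 2 * z ^+ 2.
    by rewrite !exprMn exprVn mulrAC.
  by move=> x; exact: sq.
rewrite bern_meanZ bern_mean_hoeffding_term_sqr.
set cnt := (\sum_(f : _) _)%N.
have cntE : cnt%:R <= n%:R ^+ #|V| * (#|V|%:R ^+ #|V| * n%:R ^+ (#|V| - #|edge_cover A|)) :> R.
  rewrite -!natrX -!natrM ler_nat.
  apply: (@leq_trans (\sum_(f : injection V 'I_n) #|V| ^ #|V| * n ^ (#|V| - #|edge_cover A|))%N).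
    by apply: leq_sum => f _; exact: card_same_image.
  rewrite sum_nat_const leq_mul//.
  by rewrite card_sig (leq_trans (max_card _))// card_ffun card_ord.
rewrite mulrAC ler_pdivrMr; last exact: lt_le_trans copies_scale_sqr_ge.
apply: (@le_trans _ _ (remainder_const / M * low)); last first.
  rewrite ler_wpM2l ?copies_scale_sqr_ge//.
  by rewrite divr_ge0 ?(ltW M0)// divr_ge0 ?(ltW eps0)// mulr_ge0 ?exprn_ge0.
rewrite [leRHS]mulrAC ler_pdivlMr//.
have -> : remainder_const * low = #|V|%:R ^+ #|V| * n%:R ^+ (2 * #|V| - 2) * p ^+ (2 * #|E| - 1).
  have q0 : 4 ^+ (#|V| - 1) != 0 :> R by rewrite expf_neq0.
  rewrite /remainder_const /low exprVn.
  have cancel (a q x y : R) : q != 0 -> a * q / eps * (x * q^-1 * y * eps) = a * x * y.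
    by move=> q1; field; rewrite q1 gt_eqF.
  exact: cancel.
have dens := density_bound p01 AE A2 M1.
(* With [M] replaced by its density bound and [p * (1 - p)] by [p], the powers on both sides match
   exactly. *)
apply: (@le_trans _ _ ((p ^+ (#|E| - #|A|)) ^+ 2 *
    (n%:R ^+ #|V| * (#|V|%:R ^+ #|V| * n%:R ^+ (#|V| - #|edge_cover A|)) * p ^+ #|A|) *
    (n%:R ^+ (#|edge_cover A| - 2) * p ^+ (#|A| - 1)))).
  apply: ler_pM dens; rewrite ?(ltW M0)//.
    by rewrite !mulr_ge0 ?exprn_ge0 ?mulr_ge0 ?subr_ge0 ?(ltW p0) ?(ltW p1).
  rewrite ler_wpM2l ?sqr_ge0// ler_pM ?exprn_ge0//.
  by apply: lerXn2r => //; rewrite nnegrE ltW.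
rewrite (vertex_exponent cov3 covV) (edge_exponent A2 AleE).
rewrite le_eqVlt !exprD; apply/orP; left; apply/eqP.
have regroup (a b c d u w z : R) : a ^+ 2 * (b * (c * d) * u) * (w * z) =
  c * (b * d * w) * (a * a * u * z) by ring.
exact: regroup.
Qed.

(** A first moment suffices against Lipschitz functions; the number of all edge sets crudely bounds
    the number of terms. *)
Lemma hoeffding_rest_bound :
  Ex (fun x => `|hoeffding_rest E p x / copies_scale|) <=
  #|{: {set edge V}}|%:R * Num.sqrt (remainder_const / M).
Proof.
have p01W : 0 <= p <= 1 by case/andP: p01 => p0 p1; rewrite !ltW.
pose r (A : {set edge V}) (x : {ffun edge 'I_n -> bool}) :=
  p ^+ (#|E| - #|A|) * hoeffding_term p A x / copies_scale.
apply: (@le_trans _ _ (Ex (fun x =>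
    \sum_(A : {set edge V} | (A \subset E) && (2 <= #|A|)%N) `|r A x|))).
  by apply: bern_mean_le => // x; rewrite /hoeffding_rest mulr_suml; exact: ler_norm_sum.
rewrite bern_mean_sum mulr_natl -sumr_const big_mkcond/=; apply: ler_sum => A _.
case: ifP => [/andP[AE A2]|_]; last exact: sqrtr_ge0.
apply: le_trans (bern_mean_norm_sqrt p01W _) _; rewrite ler_wsqrtr//.
exact: hoeffding_term_bound.
Qed.

(** Two edges cover at most four vertices, so [density_bound] gives [M <= n ^+ 2 * p]. Hence the
    Stein error [O(1 / s)] is also controlled by [M]. *)
Lemma bern_sd_sqr_ge_density : eps / 4 * M <= s ^+ 2.
Proof.
have /andP[p0 p1] := p01.
have /card_gt1P[e1 [e2 [e1E e2E e12]]] := E2.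
set A := [set e1; e2]%SET.
have A2 : #|A| = 2%N by rewrite cards2 e12.
have AE : A \subset E by rewrite finset.subUset !finset.sub1set e1E.
have cov4 : (#|edge_cover A| - 2 <= 2)%N.
  rewrite leq_subLR /edge_cover finset.bigcup_setU !big_set1.
  by rewrite (leq_trans (leq_card_setU _ _))// !card_edge_val.
have n1 : 1 <= n%:R :> R.
  by rewrite ler1n (leq_trans _ nV)// muln_gt0 (leq_trans _ V3).
have := density_bound p01 AE _ M1; rewrite A2 => /(_ isT); rewrite subSS subn0 expr1 => dens.
apply: le_trans bern_sd_sqr_ge.
rewrite (_ : n%:R ^+ 2 / 4 * p * eps = eps / 4 * (n%:R ^+ 2 * p)); last by ring.
rewrite ler_wpM2l ?divr_ge0 ?(ltW eps0)//; apply: le_trans dens _.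
by rewrite ler_wpM2r ?(ltW p0)// ler_weXn2l.
Qed.

End remainder.

(** * Error against Lipschitz test functions *)

Section normal_approximation.
Context {R : realType}.

Lemma lipschitz_continuous (L : R) (h : R -> R) :
  lipschitz_on_line L h -> continuous h.
Proof.
move=> hL x; apply/cvgrPdist_le => e e0.
(* The sign of [L] is not prescribed, and the constant is to be divided by. *)
have L0 : 0 < `|L| + 1 by rewrite ltr_wpDl.
near=> y; apply: le_trans (hL _ _) _.
apply: (@le_trans _ _ ((`|L| + 1) * `|x - y|)).
  by rewrite ler_wpM2r// (le_trans (ler_norm _))// lerDl.
rewrite -ler_pdivlMl//; near: y.
by apply: cvgr_dist_le; [exact: cvg_id|rewrite mulr_gt0// invr_gt0].
Unshelve. all: by end_near. Qed.

Lemma clamp_lipschitz (a b : R) :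
  `|Num.min 1 (Num.max 0 a) - Num.min 1 (Num.max 0 b)| <= `|a - b|.
Proof.
have ab := ler_norm (a - b); have := ler_norm (b - a); rewrite distrC => ba.
by rewrite /Num.min /Num.max; do ?case: ifPn; rewrite -?leNgt => *;
  rewrite ler_norml; lra.
Qed.

(** A Lipschitz substitute for the indicator of []-oo, t]]: for [d > 0] it descends linearly from 1
    to 0 between [t] and [t + d]. *)
Definition ramp (t d x : R) : R := Num.min 1 (Num.max 0 ((t + d - x) / d)).

Section ramp.
Variables (t d : R).
Hypothesis d0 : 0 < d.

Lemma ramp01 x : 0 <= ramp t d x <= 1.
Proof. by rewrite /ramp le_min ler01 le_max lexx/= ge_min lexx. Qed.

Lemma ramp1 x : x <= t -> ramp t d x = 1.
Proof.
move=> xt; rewrite /ramp; apply/min_idPl; rewrite le_max; apply/orP; right.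
by rewrite ler_pdivlMr// mul1r -subr_ge0; lra.
Qed.

Lemma ramp0 x : t + d < x -> ramp t d x = 0.
Proof.
move=> xt; rewrite /ramp max_l ?min_r// ler_pdivrMr// mul0r; lra.
Qed.

Lemma ramp_lipschitz : lipschitz_on_line d^-1 (ramp t d).
Proof.
move=> x y.
apply: le_trans (clamp_lipschitz _ _) _.
have -> : (t + d - x) / d - (t + d - y) / d = d^-1 * (y - x) by ring.
by rewrite normrM gtr0_norm ?invr_gt0// distrC.
Qed.

End ramp.

Section error.
Variables (V : finType) (E : {set edge V}) (n : nat) (p eps : R).
Hypothesis E2 : (2 <= #|E|)%N.
Hypothesis p01 : 0 < p < 1.
Hypothesis eps0 : 0 < eps.
Hypothesis peps : p <= 1 - eps.
Hypothesis nV : (2 * #|V| <= n)%N.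
Hypothesis V3 : (3 <= #|V|)%N.
Local Notation M := (n%:R * p `^ dprime R E).
Hypothesis M1 : 1 <= M.
Variables (L : R) (h : R -> R).
Hypothesis L0 : 0 <= L.
Hypothesis hL : lipschitz_on_line L h.
Hypothesis h01 : forall x, 0 <= h x <= 1.
Local Notation Ex := (bern_mean (I := edge 'I_n) p).

Local Notation T := (@copies R V E n).

(** The first term is the cost of dropping the nonlinear part inside [h]; the second is
    [stein_bound] with [C = 2] from [stein_solution], whence [5 + L = C + L + (C + 1)]. *)
Lemma copies_normal_error :
  `|Ex (fun x => h ((T x - Ex T) / copies_scale E n p)) - gauss_mean h|
  <= L * (#|{: {set edge V}}|%:R * Num.sqrt (remainder_const V eps / M))
     + (5 + L) * Num.sqrt (4 / eps / M).
Proof.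
have p01W : 0 <= p <= 1 by case/andP: p01 => p0 p1; rewrite !ltW.
have ch := lipschitz_continuous hL.
have n0 : (0 < n)%N by rewrite (leq_trans _ nV)// muln_gt0 (leq_trans _ V3).
have [p0 p1] := andP p01.
have I0 : (0 < #|{: edge 'I_n}|)%N.
  by rewrite card_edge bin_gt0 (leq_trans _ nV)// leq_pmulr// (leq_trans _ V3).
have s0 := bern_sd_gt0 p01 I0.
have sc0 : copies_scale E n p != 0.
  rewrite -sqrf_eq0 gt_eqF// (lt_le_trans _ (copies_scale_sqr_ge E2 p01 eps0 peps nV V3 M1))//.
  by rewrite !mulr_gt0 ?exprn_gt0 ?invr_gt0 ?ltr0n.
have split x : (T x - Ex T) / copies_scale E n p =
    bern_std p x + hoeffding_rest E p x / copies_scale E n p.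
  rewrite centered_copies mulrDl; congr (_ + _).
  move: sc0; rewrite /copies_scale /bern_std.
  set c := _ * p ^+ _; set S := \sum_i _.
  by rewrite mulf_eq0 negb_or => /andP[c0 _]; rewrite -mulf_div divff// mul1r.
rewrite (eq_bern_mean _ (F2 := fun x =>
  (h (bern_std p x + hoeffding_rest E p x / copies_scale E n p)
  - h (bern_std p x)) + h (bern_std p x))); last by move=> x; rewrite split subrK.
rewrite bern_meanD -addrA; apply: le_trans (ler_normD _ _) _; apply: lerD.
  apply: le_trans (bern_mean_norm p01W _) _.
  apply: (@le_trans _ _ (Ex (fun x => L * `|hoeffding_rest E p x / copies_scale E n p|))).
    by apply: bern_mean_le => // x; apply: le_trans (hL _ _) _; rewrite [X in X - _]addrC addrK.
  by rewrite bern_meanZ ler_wpM2l//; exact: hoeffding_rest_bound.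
have [f [df f2 xf2]] := stein_solution ch h01.
have m01 := gauss_mean01 ch h01.
have k1 x : `|h x - gauss_mean h| <= 1.
  by case/andP: (h01 x) => ? ?; case/andP: m01 => ? ?; rewrite ler_norml; lra.
have kL : lipschitz_on_line L (fun x => h x - gauss_mean h).
  by move=> x y; rewrite opprB addrA subrK; exact: hL.
have := stein_bound p01 I0 (ler0n _ 2) L0 df f2 xf2 k1 kL.
rewrite bern_meanB bern_mean_cst => /le_trans; apply.
rewrite (_ : 2 + L + (2 + 1) = 5 + L); last by ring.
rewrite ler_wpM2l ?addr_ge0//.
have sM := bern_sd_sqr_ge_density E2 p01 eps0 peps nV V3 M1.
have M0 : 0 < M by exact: lt_le_trans M1.
rewrite -[leLHS]ger0_norm ?invr_ge0 ?(ltW s0)// -sqrtr_sqr ler_wsqrtr//.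
rewrite exprVn (_ : 4 / eps / M = (eps / 4 * M)^-1); last by rewrite [RHS]invfM invf_div.
have low0 : 0 < eps / 4 * M by rewrite mulr_gt0 ?divr_gt0 ?ltr0n.
by rewrite lef_pV2// posrE exprn_gt0.
Qed.

End error.

End normal_approximation.

(** * Convergence in distribution *)

Section erdos_renyi_mean.
Context {R : realType} (n : nat) (p : R).
Hypothesis p01 : 0 <= p <= 1.
Local Notation Ex := (bern_mean (I := edge 'I_n) p).

Lemma erdos_renyi_expectation (F : config n -> R) :
  ('E_(erdos_renyi n p)[F] = (Ex F)%:E)%E.
Proof.
rewrite unlock.
have setTE : [set: config n] = \big[setU/set0]_(x <- enum {: config n}) [set x].
  apply/seteqP; split=> // x _; rewrite -bigcup_seq; exists x => //=.
  by rewrite mem_enum.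
rewrite setTE integral_bigsetU_EFin//=; last 2 first.
- exact: enum_uniq.
- by move=> x y _ _ [z [/= -> ->]].
rewrite big_enum/= /bern_mean -sumEFin; apply: eq_bigr => x _.
rewrite (eq_integral (cst (F x)%:E)) => [|y]; last by rewrite inE => ->.
rewrite integral_cst//= erdos_renyi_set1// -EFinM mulrC.
by [].
Qed.

Lemma erdos_renyi_mean (A : set (config n)) :
  erdos_renyi n p A = (Ex (fun x => (x \in A)%:R))%:E.
Proof. by rewrite -expectation_indic// erdos_renyi_expectation. Qed.

End erdos_renyi_mean.

(** The indicator of []-oo, t]] lies between [ramp (t - d) d] and [ramp t d], whose Gaussian means
    lie between [Phi (t - d)] and [Phi (t + d)]. Continuity at [t] fixes [d] at cost [e / 2];
    convergence for the two ramps costs another [e / 2]. *)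
Lemma cvg_in_distribution_normal {R : realType} (p : nat -> R)
    (T : forall n, config n -> R) :
  (forall n, 0 <= p n <= 1) ->
  (forall (L : R) (h : R -> R), 0 <= L -> lipschitz_on_line L h ->
    (forall x, 0 <= h x <= 1) ->
    bern_mean (p n) (fun x : {ffun edge 'I_n -> bool} => h (T n x)) @[n --> \oo]
      --> gauss_mean h) ->
  cvg_in_distribution (fun n => config_RV (erdos_renyi n (p n)) (T n))
    (normal_prob 0 1).
Proof.
move=> p01 cvT t ct.
pose Phi (s : R) : R := fine (normal_prob (0 : R) 1 `]-oo, s]).
have PhiE s : normal_prob 0 1 `]-oo, s] = (Phi s)%:E.
  by rewrite /Phi fineK// fin_num_measure.
pose F n : R :=
  bern_mean (p n) (fun x : {ffun edge 'I_n -> bool} => (T n x <= t)%R%:R).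
pose Ex n (h : R -> R) : R :=
  bern_mean (p n) (fun x : {ffun edge 'I_n -> bool} => h (T n x)).
have FE n : cdf (config_RV (erdos_renyi n (p n)) (T n)) t = (F n)%:E.
  rewrite /cdf /distribution /pushforward/= erdos_renyi_mean//.
  congr EFin; apply: eq_bern_mean => x; congr (nat_of_bool _)%:R.
  by apply/idP/idP; rewrite inE/= in_itv.
rewrite (_ : (fun n => cdf _ t) = (fun n => (F n)%:E)); last exact/funext.
suff cvgF : (F n)%:E @[n --> \oo] --> (Phi t)%:E by rewrite -PhiE in cvgF; exact: cvgF.
apply: cvg_EFin; first by near=> n.
apply/cvgrPdist_le => e e0.
have [d d0 ctd] : exists2 d : R, 0 < d & forall s, `|t - s| <= d -> `|Phi t - Phi s| <= e / 2.
  have cPhi : Phi s @[s --> t] --> Phi t.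
    by apply: fine_cvg; rewrite -PhiE; exact: ct.
  have e20 : 0 < e / 2 by rewrite divr_gt0.
  move/cvgrPdist_le : cPhi => /(_ _ e20)/nbhs_ballP[d /= d0 dPhi].
  (* Halving passes from the strict inequality of the ball to a non-strict one. *)
  exists (d / 2); first by rewrite divr_gt0.
  by move=> s ts; apply: dPhi; rewrite /ball/=; lra.
have L0 : 0 <= d^-1 by rewrite invr_ge0 ltW.
have ramp_cvg s := cvT _ _ L0 (ramp_lipschitz s d0) (ramp01 s d).
have ramp_near s : \forall n \near \oo,
    `|gauss_mean (ramp s d) - Ex n (ramp s d)| <= e / 2.
  by have /cvgrPdist_le := ramp_cvg s; apply; rewrite divr_gt0.
have cramp s := lipschitz_continuous (ramp_lipschitz s d0).
near=> n; rewrite -[(_ \o _) n]/(F n).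
have up : `|gauss_mean (ramp t d) - Ex n (ramp t d)| <= e / 2.
  by near: n; exact: ramp_near.
have low : `|gauss_mean (ramp (t - d) d) - Ex n (ramp (t - d) d)| <= e / 2.
  by near: n; exact: ramp_near.
have Fup : F n <= Ex n (ramp t d).
  apply: bern_mean_le => // x; have [xt|_] := leP (T n x) t.
    by rewrite ramp1.
  by have /andP[] := ramp01 t d (T n x).
have Flow : Ex n (ramp (t - d) d) <= F n.
  apply: bern_mean_le => // x; have [_|xt] := leP (T n x) t.
    by have /andP[] := ramp01 (t - d) d (T n x).
  by rewrite ramp0// subrK.
have mup : gauss_mean (ramp t d) <= Phi (t + d).
  rewrite -lee_fin -PhiE; apply: gauss_mean_le => // [|x]; first exact: ramp01.
  exact: ramp0.
have mlow : Phi (t - d) <= gauss_mean (ramp (t - d) d).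
  rewrite -lee_fin -PhiE; apply: gauss_mean_ge => // [|x]; first exact: ramp01.
  exact: ramp1.
have c1 : `|Phi t - Phi (t + d)| <= e / 2.
  by apply: ctd; rewrite opprD addrA subrr add0r normrN gtr0_norm.
have c2 : `|Phi t - Phi (t - d)| <= e / 2.
  by apply: ctd; rewrite opprB addrC subrK gtr0_norm.
rewrite ler_norml; apply/andP; split.
  rewrite lerNl opprB lerBlDl (le_trans Fup)//.
  by move: up c1 mup; rewrite !ler_norml; clear; lra.
rewrite lerBlDr -lerBlDl (le_trans _ Flow)//.
by move: low c2 mlow; rewrite !ler_norml; clear; lra.
Unshelve. all: by end_near. Qed.

Lemma cvg_sqrt_div0 {R : realType} (c : R) (u : nat -> R) :
  u n @[n --> \oo] --> +oo -> Num.sqrt (c / u n) @[n --> \oo] --> 0.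
Proof.
move=> uoo.
have u0 : \forall n \near \oo, 0 < u n.
  by move/cvgryPge : uoo => /(_ 1); apply: filterS => n; exact: lt_le_trans.
have c0 : c / u n @[n --> \oo] --> 0.
  by rewrite -[0](mulr0 c); apply: cvgM; [exact: cvg_cst|exact/(gtr0_cvgV0 u0)].
by rewrite -[0]sqrtr0; apply: (cvg_comp _ _ c0); exact: sqrt_continuous.
Qed.

Theorem theorem3p5 (R : realType) (V : finType) (E : {set edge V})
    (hconn : connected_graph E) (hE : (2 <= #|E|)%N)
    (p : nat -> R) (hp : forall n, 0 < p n < 1)
    (eps : R) (heps : 0 < eps) (hpeps : forall n, p n <= 1 - eps)
    (hlim : n%:R * p n `^ dprime R E * ln (1 / p n) ^- #|E|
              @[n --> \oo] --> +oo) :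
  cvg_in_distribution
    (fun n => config_RV (erdos_renyi n (p n)) (fun X : config n =>
       (subgraph_count R E X
          - fine ('E_(erdos_renyi n (p n))[subgraph_count R E])) /
       (2 * #|graph_aut E|%:R^-1 * #|E|%:R * ((n - 2) ^_ (#|V| - 2))%:R
          * p n ^+ (#|E| - 1)
          * Num.sqrt ('C(n, 2)%:R * p n * (1 - p n)))))
    (normal_prob 0 1).
Proof.
have p01 n : 0 <= p n <= 1 by have /andP[? ?] := hp n; rewrite !ltW.
have V3 : (3 <= #|V|)%N := leq_trans (card_edge_cover_ge hE) (max_card _).
pose M n := n%:R * p n `^ dprime R E.
(* As [p n <= 1 - eps], the logarithm is at least a constant [c > 0], so the logarithmic factor is
   at most [c ^- #|E|] and [M] itself diverges. *)
have M_oo : M n @[n --> \oo] --> +oo.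
  have /andP[p0 _] := hp 0%N.
  have eps1 : 0 < 1 - eps by exact: lt_le_trans (hpeps 0%N).
  pose c := ln (1 / (1 - eps)).
  have c0 : 0 < c by rewrite ln_gt0// ltr_pdivlMr//; lra.
  apply/cvgryPge => a; move/cvgryPge : hlim => /(_ (a / c ^+ #|E|)).
  apply: filterS => n; rewrite ler_pdivrMr ?exprn_gt0// => /le_trans; apply.
  have /andP[pn0 pn1] := hp n.
  have cln : c <= ln (1 / p n).
    rewrite ler_ln ?posrE ?divr_gt0// !div1r lef_pV2 ?posrE//.
  have ln0 : 0 < ln (1 / p n) by exact: lt_le_trans cln.
  rewrite -/(M n) -mulrA ler_piMr ?mulr_ge0 ?powR_ge0//.
  by rewrite mulrC ler_pdivrMr ?exprn_gt0// [leRHS]mul1r lerXn2r// nnegrE ltW.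
(* The identity is an automorphism; [1 / |Aut(G)|] can then be cancelled between numerator and
   denominator. *)
have aut0 : #|graph_aut E|%:R != 0 :> R.
  rewrite pnatr_eq0 -lt0n; apply/card_gt0P; exists 1%g; rewrite inE.
  by apply/forallP => x; apply/forallP => y; rewrite !perm1.
rewrite (_ : (fun n => config_RV _ _) =
    (fun n => config_RV (erdos_renyi n (p n)) (fun x : config n =>
      (copies E x - bern_mean (p n) (@copies R V E n)) / copies_scale E n (p n)))); last first.
  apply: functional_extensionality_dep => n; apply: (congr1 (config_RV _)); apply/funext => x.
  rewrite erdos_renyi_expectation//= /subgraph_count bern_meanZ -/(copies E x) -mulrBr.
  rewrite /copies_scale /bern_sd card_edge.
  have cancel (a b c d e f : R) : a != 0 ->
      a^-1 * b / (2 / a * c * d * e * f) = b / (2 * c * d * e * f).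
    move=> a0; have -> : 2 / a * c * d * e * f = a^-1 * (2 * c * d * e * f) by ring.
    by rewrite -mulf_div divff ?invr_eq0// mul1r.
  exact: cancel.
apply: cvg_in_distribution_normal => // L h L0 hL h01.
pose err n := L * (#|{: {set edge V}}|%:R * Num.sqrt (remainder_const V eps / M n))
  + (5 + L) * Num.sqrt (4 / eps / M n).
have err0 : err n @[n --> \oo] --> 0.
  rewrite -[0](addr0 0); apply: cvgD.
    rewrite -[X in _ --> X](mulr0 L) -[X in L * X](mulr0 #|{: {set edge V}}|%:R).
    by apply: cvgM; [exact: cvg_cst|apply: cvgM; [exact: cvg_cst|exact: cvg_sqrt_div0]].
  rewrite -[X in _ --> X](mulr0 (5 + L)).
  by apply: cvgM; [exact: cvg_cst|exact: cvg_sqrt_div0].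
apply/cvgrPdist_le => e e0; near=> n.
have M1 : 1 <= M n by near: n; move/cvgryPge : M_oo; exact.
have nV : (2 * #|V| <= n)%N by near: n; exact: nbhs_infty_ge.
have errn : `|err n| <= e by near: n; move/cvgr0Pnorm_le : err0; exact.
rewrite distrC; apply: le_trans errn; apply: le_trans (ler_norm _).
exact: (copies_normal_error hE (hp n) heps (hpeps n) nV V3 M1 L0 hL h01).
Unshelve. all: by end_near. Qed.
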